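(* For every integer $n>8750$, the number of nice words of length $n$ satisfies $$|\mathcal N_n|>\frac{1.01^n}{7.8}.$$
   Context: Words are over $\{0,1,2\}$. A word $s_1\ldots s_{2m}$ ($m\ge1$) is a square if $s_i=s_{i+m}$ for all $i\le m$; a word is square-free if no factor of it is a square. $\overline w$ is the mirror image of $w$. Let $q=1202120121021201021$, $\overline{q}=1201021201210212021$, $p=\overline{q}\,0\,q$. A word $v$ is nice if $p\,v\,p$ is square-free and contains exactly two occurrences of $q$ and exactly two occurrences of $\overline q$. $\mathcal N_n$ is the set of nice words of length $n$. *)

(* Defs.v *)
From mathcomp Require Import all_boot all_order all_algebra.

Set Implicit Arguments.
Unset Strict Implicit.
Unset Printing Implicit Defensive.

Definition word := seq 'I_3.

(* The length determines m, so m is taken to be half of it; letters are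
   numbered from 0. *)
Definition square (w : word) : bool :=
  let m := (size w)./2 in
  [&& 0 < m, size w == 2 * m &
      all (fun i => nth ord0 w i == nth ord0 w (i + m)) (iota 0 m)].

Definition factors (w : word) : seq word :=
  [seq take l (drop i w) | i <- iota 0 (size w).+1, l <- iota 0 (size w).+1].

Definition square_free (w : word) : bool :=
  all (fun u => ~~ square u) (factors w).

(* Number of positions at which u occurs in w (overlaps allowed). *)
Definition occurrences (u w : word) : nat :=
  count (fun i => prefix u (drop i w)) (iota 0 (size w).+1).

(* On the literals 0, 1, 2 inZp is the injection into 'I_3. *)
Definition q : word :=
  map inZp [:: 1; 2; 0; 2; 1; 2; 0; 1; 2; 1; 0; 2; 1; 2; 0; 1; 0; 2; 1].

Definition qbar : word := rev q.

Definition p : word := qbar ++ inZp 0 :: q.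

Definition nice (v : word) : bool :=
  let w := p ++ v ++ p in
  [&& square_free w, occurrences q w == 2 & occurrences qbar w == 2].

Definition nice_words (n : nat) : {set n.-tuple 'I_3} :=
  [set v : n.-tuple 'I_3 | nice v].

Lemma squareP (w : word) :
  reflect (exists m, [/\ 0 < m, size w = 2 * m &
             forall i, i < m -> nth ord0 w i = nth ord0 w (i + m)])
          (square w).
Proof.
apply: (iffP and3P) => [[m_gt0 /eqP sz /allP eqw]|[m [m_gt0 sz eqw]]].
  exists (size w)./2; split=> // i lt_im.
  by apply/eqP/eqw; rewrite mem_iota.
have -> : (size w)./2 = m by rewrite sz mul2n doubleK.
split; rewrite ?sz //; apply/allP => i; rewrite mem_iota => /andP[_ lt_im].
by rewrite eqw.
Qed.

Lemma mem_factors (u w : word) : (u \in factors w) = infix u w.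
Proof.
apply/allpairsP/infixP => [[[i l] [_ _ ->]]|[s [t ->]]].
  exists (take i w), (drop l (drop i w)).
  by rewrite /= cat_take_drop cat_take_drop.
exists (size s, size u); rewrite !mem_iota /= drop_size_cat // take_size_cat //.
by rewrite !size_cat !add0n !ltnS leq_addr addnCA leq_addr.
Qed.

Lemma square_freeP (w : word) :
  reflect (forall u, infix u w -> ~~ square u) (square_free w).
Proof.
by apply: (iffP allP) => sqf u; have := sqf u; rewrite mem_factors.
Qed.

Lemma qbarE :
  qbar = map inZp [:: 1; 2; 0; 1; 0; 2; 1; 2; 0; 1; 2; 1; 0; 2; 1; 2; 0; 2; 1].
Proof. by []. Qed.

(* Main.v *)
Require Import Defs.
From mathcomp Require Import all_boot all_order all_algebra.
From mathcomp Require Import zify lra.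

Set Implicit Arguments.
Unset Strict Implicit.
Unset Printing Implicit Defensive.

(* A Brinkhuis pair: replacing each letter of a square-free ternary word u by
   one of two images of length 18, chosen independently, yields a square-free
   word, and the pair below also avoids q and its mirror image.  Such a word,
   trimmed by 4 letters at both ends, is joined to p on either side by a short
   connector, first on the right, then on the left.  At each step the 13
   letters across the junction (the marker) occur nowhere in the word being
   extended: a square reaching into the new part is either impossible, because
   its half would contain the marker, or short enough for a finite check.  The
   left connector has one of 18 consecutive lengths, so that every large n is
   reached, and the free choices give about 2^(n/18) > 1.01^n nice words.
   Letters are natural numbers during the computations. *)

(** * Squares in words of natural numbers, with executable tests *)

Fixpoint agree m (x y : seq nat) : bool :=
  if m is m'.+1 then
    if x is a :: x' then
      if y is b :: y' then if eqn a b then agree m' x' y' else false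
      else false
    else false
  else true.

Lemma agreeP m x y :
  reflect [/\ m <= size x, m <= size y &
             forall k, k < m -> nth 0 x k = nth 0 y k] (agree m x y).
Proof.
elim: m x y => [|m IHm] [|a x] [|b y] /=; try by constructor=> // -[].
have [/eqP ->|/eqP neq_ab] := boolP (eqn a b).
  apply: (iffP (IHm x y)) => [[lx ly eqxy]|[lx ly eqxy]]; split=> //.
    by case=> [|k] //= /eqxy.
  by move=> k ltkm; apply: (eqxy k.+1).
by constructor=> -[_ _ /(_ 0 isT)].
Qed.

Definition square_at w i m := (0 < m) && agree m (drop i w) (drop (i + m) w).

Lemma square_atP w i m :
  reflect [/\ 0 < m, i + 2 * m <= size w &
             forall k, k < m -> nth 0 w (i + k) = nth 0 w (i + m + k)]
          (square_at w i m).
Proof.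
apply: (iffP andP) => [[m_gt0 /agreeP[]]|[m_gt0 le_w eqw]].
  rewrite !size_drop => l1 l2 eqw; split=> // [|k /eqw]; first lia.
  by rewrite !nth_drop.
split=> //; apply/agreeP; rewrite !size_drop; split; [lia | lia |].
by move=> k /eqw; rewrite !nth_drop.
Qed.

Definition squarefree w := forall i m, ~~ square_at w i m.

Lemma square_at_cat x y t i m :
  square_at y i m -> square_at (x ++ y ++ t) (size x + i) m.
Proof.
case/square_atP=> m_gt0 le_y eqy; apply/square_atP; split=> // [|k ltkm].
  by rewrite !size_cat; lia.
rewrite -!addnA !nth_cat !ltnNge !leq_addr /= !addKn.
have -> : (size y <= i + k) = false by lia.
have -> : (size y <= i + (m + k)) = false by lia.
by rewrite /= addnA; apply: eqy.
Qed.

Lemma square_at_drop w i j m :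
  square_at (drop j w) i m = square_at w (j + i) m.
Proof.
rewrite /square_at !drop_drop; congr (_ && agree _ (drop _ _) (drop _ _)); lia.
Qed.

Lemma square_at_take w l i m :
  i + 2 * m <= l -> square_at w i m -> square_at (take l w) i m.
Proof.
move=> le_l /square_atP[m_gt0 le_w eqw]; apply/square_atP; split=> // [|k ltkm].
  by rewrite size_take_min leq_min le_l.
by rewrite !nth_take; try lia; apply: eqw.
Qed.

Lemma squarefree_infix x w : infix x w -> squarefree w -> squarefree x.
Proof.
case/infixP=> s [t ->] sqw i m; apply/negP => /(square_at_cat s t).
exact/negP.
Qed.

Lemma squarefree_rev w : squarefree w -> squarefree (rev w).
Proof.
move=> sqw i m; apply/negP => /square_atP[m_gt0]; rewrite size_rev => le_w eqw.
have /negP[] := sqw (size w - i - 2 * m) m; apply/square_atP; split=> // [|k ltkm].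
  lia.
have := eqw (m - k.+1); rewrite !nth_rev; try lia.
have -> : size w - (i + (m - k.+1)).+1 = size w - i - 2 * m + m + k by lia.
have -> : size w - (i + m + (m - k.+1)).+1 = size w - i - 2 * m + k by lia.
by move=> -> //; lia.
Qed.

(* [nosq k m w (drop m w)] says that no square with half-length in
   [m, m + k) is a prefix of [w]. *)
Fixpoint nosq k m (w y : seq nat) : bool :=
  if k is k'.+1 then
    if agree m w y then false else nosq k' m.+1 w (behead y)
  else true.

Lemma nosqP k m w :
  reflect (forall j, m <= j < m + k -> ~~ agree j w (drop j w))
          (nosq k m w (drop m w)).
Proof.
elim: k m => [|k IHk] m /=; first by constructor=> j; lia.
have [ag|nag] := boolP (agree m w (drop m w)).
  by constructor=> H; have := H m; rewrite ag => /(_ ltac:(lia)).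
rewrite -drop1 drop_drop add1n; apply: (iffP (IHk m.+1)) => H j rj; last first.
  by apply: H; lia.
by have [->|ne] := eqVneq j m; last by apply: H; lia.
Qed.

Fixpoint nosq_starts n k (w : seq nat) : bool :=
  if n is n'.+1 then
    if nosq k 1 w (behead w) then nosq_starts n' k (behead w) else false
  else true.

Lemma nosq_startsP n k w i m :
  nosq_starts n k w -> i < n -> m <= k -> ~~ square_at w i m.
Proof.
elim: n w i => // n IHn w i /=; rewrite -!drop1.
case: nosqP => // nsq ns ltin lemk; case: i ltin => [_|i ltin].
  rewrite /square_at drop0; case: posnP => //= m_gt0.
  by apply: nsq; lia.
by have := IHn _ i ns ltin lemk; rewrite square_at_drop add1n.
Qed.

(** * Occurrences, overlaps and gluing *)

Fixpoint occ (T : eqType) (u w : seq T) : nat :=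
  prefix u w + (if w is _ :: w' then occ u w' else 0).

Lemma occ_cons (T : eqType) (u : seq T) a w :
  occ u (a :: w) = prefix u (a :: w) + occ u w.
Proof. by []. Qed.

Lemma occ_eq0 (T : eqType) (u w : seq T) : (occ u w == 0) = ~~ infix u w.
Proof.
elim: w => [|a w IHw]; first by case: u.
by rewrite occ_cons addn_eq0 eqb0 IHw infix_consl negb_or.
Qed.

Lemma prefix_cat_short (T : eqType) (u x t : seq T) :
  size u <= size x -> prefix u (x ++ t) = prefix u x.
Proof. by move=> leux; rewrite !prefixE takel_cat. Qed.

(** A factor meeting both [x] and [t] has at least [size y + 2] letters, so each occurrence of [u]
    lies in [x ++ y] or in [y ++ t]; those inside [y] are counted twice. *)
Lemma occ_cat_overlap (T : eqType) (u x y t : seq T) :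
  size u <= (size y).+1 ->
  occ u (x ++ y ++ t) + occ u y = occ u (x ++ y) + occ u (y ++ t).
Proof.
move=> leuy; elim: x => [|a x IHx]; first by rewrite addnC.
rewrite !cat_cons !occ_cons -addnA IHx addnA; congr (_ + _ + _).
by rewrite catA -cat_cons prefix_cat_short //= size_cat; lia.
Qed.

Lemma infix_cat_overlap (T : eqType) (u x y t : seq T) :
  size u <= (size y).+1 -> infix u (x ++ y ++ t) ->
  infix u (x ++ y) || infix u (y ++ t).
Proof.
move=> leuy; apply: contraTT; rewrite negb_or -!occ_eq0 => /andP[/eqP o1 /eqP o2].
by have := occ_cat_overlap x t leuy; rewrite o1 o2; case: (occ _ _).
Qed.

Lemma prefix_dropP (u w : seq nat) i : 0 < size u ->
  reflect (i + size u <= size w /\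
             forall k, k < size u -> nth 0 u k = nth 0 w (i + k))
          (prefix u (drop i w)).
Proof.
move=> u_gt0; rewrite prefixE; apply: (iffP eqP) => [eq_u|[le_w eq_u]].
  have := congr1 size eq_u; rewrite size_take_min size_drop => sz.
  have {}sz : minn (size u) (size w - i) = size u := sz.
  by split=> [|k ltk]; [lia | rewrite -{1}eq_u nth_take // nth_drop].
have sz : size (take (size u) (drop i w)) = size u.
  by rewrite size_take_min size_drop; lia.
apply: (@eq_from_nth _ 0) => // k; rewrite sz => ltk.
by rewrite nth_take // nth_drop eq_u.
Qed.

Lemma infix_take_drop (T : eqType) l j (w : seq T) : infix (take l (drop j w)) w.
Proof. exact: infix_trans (infix_take _ _) (infix_drop _ _). Qed.

Lemma prefix_drop_infix (T : eqType) (u w : seq T) i :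
  prefix u (drop i w) -> infix u w.
Proof.
move=> /prefixP[t eq_t]; apply/infixP; exists (take i w), t.
by rewrite -eq_t cat_take_drop.
Qed.

(* A square starting in [l] is either short enough to lie in [l ++ y], or its
   half contains the marker, which then occurs again in [y ++ t]. *)
Lemma squarefree_glue l y t g :
  0 < size l -> size l + 2 * g <= (size y).+2 -> g <= size y ->
  nosq_starts (size l) (size l + g).-1 (l ++ y) ->
  ~~ infix (last 0 l :: take g y) (y ++ t) ->
  squarefree (y ++ t) -> squarefree (l ++ y ++ t).
Proof.
move=> l_gt0 le_y le_g nsq nin sqyt i m; apply/negP => sq.
have [le_li|lt_il] := leqP (size l) i.
  move: sq; rewrite -(subnKC le_li) -square_at_drop drop_size_cat //.
  exact/negP.
have /square_atP[m_gt0 le_w eqw] := sq.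
have [lt_m|le_m] := ltnP m (size l + g - i).
  have le_m : m <= (size l + g).-1 by lia.
  have /negP[] := nosq_startsP nsq lt_il le_m.
  suff -> : l ++ y = take (size (l ++ y)) (l ++ y ++ t).
    by apply: square_at_take => //; rewrite size_cat; lia.
  by rewrite catA take_size_cat.
(* The marker starts at [(size l).-1] and lies in the first half. Its copy [m] letters later starts
   at position [m.-1] of [y ++ t]. *)
case/negP: nin; apply: (@prefix_drop_infix _ _ _ m.-1).
have mark k : k <= g -> nth 0 (last 0 l :: take g y) k
                       = nth 0 (l ++ y ++ t) ((size l).-1 + k).
  case: k => [_|k ltkg] /=.
    by rewrite addn0 nth_cat prednK // leqnn nth_last.
  rewrite nth_take // addnS -addSn prednK // nth_cat ltnNge leq_addr /= addKn.
  by rewrite nth_cat ifT //; lia.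
apply/prefix_dropP => //; rewrite /= size_takel //.
move: le_w; rewrite !size_cat => le_w; split; first by lia.
move=> k; rewrite ltnS => lekg; rewrite mark //.
have -> : (size l).-1 + k = i + ((size l).-1 - i + k) by lia.
rewrite eqw; last lia.
have -> : i + m + ((size l).-1 - i + k) = size l + (m.-1 + k) by lia.
by rewrite nth_cat ltnNge leq_addr /= addKn.
Qed.

(** * Enumeration of square-free ternary words and of codes *)

Definition ternary (w : seq nat) := all (fun a => a < 3) w.

Fixpoint sqf_words n : seq (seq nat) :=
  if n is n'.+1 then
    [seq w <- [seq a :: w | w <- sqf_words n', a <- [:: 0; 1; 2]]
     | nosq n' 1 w (behead w)]
  else [:: [::]].

Lemma sqf_wordsS n : sqf_words n.+1 =
  [seq w <- [seq a :: w | w <- sqf_words n, a <- [:: 0; 1; 2]]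
   | nosq n 1 w (behead w)].
Proof. by []. Qed.

Lemma mem_sqf_words w :
  ternary w -> squarefree w -> w \in sqf_words (size w).
Proof.
elim: w => [|a w IHw] // /andP[lta tw] sqaw.
rewrite [size _]/= sqf_wordsS mem_filter [behead _]/=; apply/andP; split.
  rewrite -{3}(drop0 w); apply/(@nosqP _ 1 (a :: w)) => -[|j] // _.
  by have := sqaw 0 j.+1; rewrite /square_at drop0.
apply/allpairsP; exists (w, a); split=> //=.
  apply: IHw => //; apply: squarefree_infix sqaw.
  by apply/infixP; exists [:: a], [::]; rewrite cats0.
by move: a lta {sqaw} => [|[|[|]]].
Qed.

Fixpoint lifts (w : seq nat) : seq (seq (nat * bool)) :=
  if w is a :: w' then
    [seq (a, b) :: c | c <- lifts w', b <- [:: false; true]]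
  else [:: [::]].

Lemma liftsS a w : lifts (a :: w) =
  [seq (a, b) :: c | c <- lifts w, b <- [:: false; true]].
Proof. by []. Qed.

Lemma mem_lifts c : c \in lifts (unzip1 c).
Proof.
elim: c => [|[a b] c IHc] //; rewrite [unzip1 _]/= liftsS.
by apply/allpairsP; exists (c, b); split=> //; case: b.
Qed.

(* A code is a word of pairs (letter, choice of one of its two images). *)
Definition codes n := flatten [seq lifts w | w <- sqf_words n].

Definition sqf_code (c : seq (nat * bool)) :=
  ternary (unzip1 c) /\ squarefree (unzip1 c).

Lemma mem_codes c : sqf_code c -> c \in codes (size c).
Proof.
case=> tc sqc; apply/flatten_mapP; exists (unzip1 c); last exact: mem_lifts.
by rewrite -(size_map fst) mem_sqf_words.
Qed.

Lemma sqf_code_infix c1 c : infix c1 c -> sqf_code c -> sqf_code c1.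
Proof.
case/infixP=> s [t ->] []; rewrite /ternary /unzip1 !map_cat !all_cat.
case/and3P=> _ tc1 _ sqc; split=> //; apply: squarefree_infix sqc.
by apply/infixP; exists (map fst s), (map fst t).
Qed.

(** * The Brinkhuis pair and its images *)

(* Reversing [block0] gives the second image of 0, and adding a letter modulo 3
   gives the images of that letter. *)
Definition block0 : seq nat :=
  [:: 0; 2; 1; 0; 1; 2; 0; 1; 0; 2; 0; 1; 2; 1; 0; 1; 2; 0].

Definition block (x : nat * bool) : seq nat :=
  let w := [seq (a + x.1) %% 3 | a <- block0] in if x.2 then rev w else w.

Definition img c := flatten [seq block x | x <- c].

Lemma size_block x : size (block x) = 18.
Proof. by case: x => a []. Qed.

Lemma ternary_block x : ternary (block x).
Proof.
rewrite /ternary; case: x => a b; suff: all (fun a => a < 3) (block (a, false)).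
  by case: b; rewrite /block ?all_rev.
by rewrite all_map; apply/allP => i _ /=; rewrite ltn_mod.
Qed.

(** [block0] begins and ends with 0, so both images of a letter begin with that letter. *)
Lemma head_block x : x.1 < 3 -> nth 0 (block x) 0 = x.1.
Proof. by case: x => [[|[|[|]]] []]. Qed.

Lemma rev_block x : rev (block x) = block (x.1, ~~ x.2).
Proof. by case: x => a [] //; rewrite /block revK. Qed.

Lemma img_cat c1 c2 : img (c1 ++ c2) = img c1 ++ img c2.
Proof. by rewrite /img map_cat flatten_cat. Qed.

Lemma rev_img c : rev (img c) = img (rev [seq (x.1, ~~ x.2) | x <- c]).
Proof.
elim: c => // x c IHc.
rewrite /= rev_cons -cats1 img_cat -IHc [img (_ :: _)]/= rev_cat rev_block.
by rewrite {2}/img /= cats0.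
Qed.

Lemma size_img c : size (img c) = 18 * size c.
Proof. by elim: c => // x c IHc; rewrite /= size_cat size_block IHc mulnS. Qed.

Lemma ternary_img c : ternary (img c).
Proof.
elim: c => // x c IHc; rewrite /ternary all_cat.
by apply/andP; split; first exact: ternary_block.
Qed.

Lemma drop_img j c : drop (18 * j) (img c) = img (drop j c).
Proof.
elim: j c => [|j IHj] [|x c] //=; first by rewrite drop0.
by rewrite mulnS drop_cat size_block ltnNge leq_addr /= addKn IHj.
Qed.

Lemma take_img j c : take (18 * j) (img c) = img (take j c).
Proof.
elim: j c => [|j IHj] [|x c] //=; first by rewrite take0.
by rewrite mulnS take_cat size_block ltnNge leq_addr /= addKn IHj.
Qed.

Lemma nth_img j c : ternary (unzip1 c) ->
  nth 0 (img c) (18 * j) = nth 0 (unzip1 c) j.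
Proof.
move=> tc; rewrite -[18 * j]addn0 -nth_drop drop_img.
rewrite -[X in nth 0 (unzip1 c) X]addn0 -nth_drop /unzip1 -map_drop.
case E: (drop j c) => [|x s] //=; rewrite nth_cat size_block /=.
apply: head_block; apply: (allP tc); apply: map_f.
by apply: (@mem_drop j); rewrite E mem_head.
Qed.

(** A square with half-length at most 34 starting in the first block ends within 17 + 68 = 85
    letters, hence within five blocks. *)
Lemma short_squares_check :
  all (fun n => all (fun c => nosq_starts 18 34 (img c)) (codes n)) (iota 0 6).
Proof. by vm_cast_no_check (erefl true). Qed.

(** Dropping the first and last of the 36 letters leaves exactly the offsets 1 to 17, those not
    aligned with a block. *)
Lemma sync_check :
  all (fun c2 => all (fun c1 => ~~ infix (img c1) (take 34 (behead (img c2))))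
                     (codes 1)) (codes 2).
Proof. by vm_cast_no_check (erefl true). Qed.

Lemma sync c1 c2 r : sqf_code c1 -> sqf_code c2 -> size c1 = 1 -> size c2 = 2 ->
  prefix (img c1) (drop r (img c2)) -> r < 18 -> r = 0.
Proof.
move=> sq1 sq2 s1 s2; case: r => // r pre ltr.
have := allP sync_check c2; rewrite -s2 mem_codes // => /(_ isT) /allP /(_ c1).
rewrite -s1 mem_codes // => /(_ isT) /negP[].
move: pre => /prefixP[t eqt]; apply: (@prefix_drop_infix _ _ _ r).
have sz1 : size (img c1) = 18 by rewrite size_img s1.
rewrite prefixE sz1 -drop1 take_drop take_takel; last lia.
by rewrite -take_drop drop_drop addn1 eqt take_size_cat.
Qed.

(* A square with half-length at least 35 contains a whole block in its first
   half, so the half-length is a multiple of 18; reading the first letter of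
   each block then gives a square in the preimage. *)
Lemma squarefree_img c : sqf_code c -> squarefree (img c).
Proof.
move=> sqc i m; apply/negP => sq; have [m_gt0] := square_atP _ _ _ sq.
rewrite size_img => le_c eqw.
have [lt35|le35] := ltnP m 35.
  pose j := i %/ 18; pose c5 := take 5 (drop j c).
  have inf5 : infix c5 c by apply: infix_take_drop.
  have le5 : size c5 \in iota 0 6 by rewrite mem_iota /= size_take_min; lia.
  have c5_in := mem_codes (sqf_code_infix inf5 sqc).
  have /(nosq_startsP (i := i %% 18) (m := m)) nsq :=
    allP (allP short_squares_check _ le5) _ c5_in.
  have /negP[] : ~~ square_at (img c5) (i %% 18) m by apply: nsq; lia.
  rewrite /c5 -take_img; apply: square_at_take; first lia.
  by rewrite -drop_img square_at_drop mulnC -divn_eq.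
have [tc sqc1] := sqc.
(* Block [j] is the first one starting at or after [i]; it ends by [i + 35], hence within the first
   half. *)
pose j := (i + 17) %/ 18.
have dvd_m : 18 %| m.
  pose P := 18 * j + m.
  pose c1 := take 1 (drop j c); pose c2 := take 2 (drop (P %/ 18) c).
  have [/eqP r0|r_n0] := boolP (P %% 18 == 0); first by rewrite /P in r0; lia.
  have inf1 : infix c1 c by apply: infix_take_drop.
  have inf2 : infix c2 c by apply: infix_take_drop.
  suff r0 : P %% 18 = 0 by rewrite r0 in r_n0.
  have sz1 : size c1 = 1 by rewrite size_take_min size_drop; lia.
  have sz2 : size c2 = 2 by rewrite size_take_min size_drop; lia.
  apply: (@sync c1 c2) => //; try exact: sqf_code_infix sqc.
  have ic1 : img c1 = take 18 (drop (18 * j) (img c)) by rewrite drop_img -take_img.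
  have ic2 : img c2 = take 36 (drop (18 * (P %/ 18)) (img c)) by rewrite drop_img -take_img.
    apply/prefix_dropP; rewrite ?size_img ?sz1 ?sz2 //; split; first lia.
    move=> k ltk; rewrite ic1 ic2 !nth_take ?nth_drop; try lia.
    have -> : 18 * (P %/ 18) + (P %% 18 + k) = i + m + (18 * j - i + k) by lia.
    by rewrite -eqw; [congr nth; lia | lia].
  by rewrite ltn_mod.
have /negP[] := sqc1 j (m %/ 18); apply/square_atP; split; first lia.
  by rewrite size_map; lia.
move=> k ltk; rewrite -!nth_img //.
have -> : 18 * (j + k) = i + (18 * j - i + 18 * k) by lia.
by rewrite eqw; [congr nth; lia | lia].
Qed.

Definition avoided u := all (fun c => ~~ infix u (img c)) (codes 3).

(* Blocks have length 18, so that 37 consecutive letters lie in three blocks. *)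
Lemma avoided_img u c :
  size u <= 37 -> avoided u -> 2 < size c -> sqf_code c -> ~~ infix u (img c).
Proof.
move=> le_u avu; elim: c => // x c IHc; rewrite [size _]/= ltnS leq_eqVlt.
case/predU1P=> [sz|ltc] sqc.
  by have := mem_codes sqc; rewrite [size _]/= -sz; apply: (allP avu).
have sqc' : sqf_code c.
  by apply: sqf_code_infix sqc; apply/infixP; exists [:: x], [::]; rewrite cats0.
rewrite -[c](cat_take_drop 2) -cat1s !img_cat; apply/negP.
have sz2 : size (take 2 c) = 2 by rewrite size_takel // ltnW.
case/infix_cat_overlap/orP; first by rewrite size_img sz2.
  rewrite -img_cat; apply/negP; apply: (allP avu).
  rewrite (_ : 3 = size ([:: x] ++ take 2 c)); last by rewrite size_cat sz2.
  apply: mem_codes; apply: sqf_code_infix sqc.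
  by apply/infixP; exists [::], (drop 2 c); rewrite /= cat_take_drop.
by rewrite -img_cat cat_take_drop; apply/negP/IHc.
Qed.

(** * Connectors and the finite checks at the junctions *)

Definition qn : seq nat :=
  [:: 1; 2; 0; 2; 1; 2; 0; 1; 2; 1; 0; 2; 1; 2; 0; 1; 0; 2; 1].

Definition pn := rev qn ++ 0 :: qn.

(* Found by computer search, like [last_connector]; the lengths are 10 to 27. *)
Definition connectors : seq (seq nat) :=
  [:: [:: 0; 1; 2; 1; 0; 2; 0; 1; 0; 2];
    [:: 0; 1; 2; 1; 0; 2; 0; 1; 2; 0; 2];
    [:: 0; 1; 2; 0; 1; 0; 2; 0; 1; 2; 0; 2];
    [:: 0; 1; 2; 0; 1; 0; 2; 0; 1; 2; 1; 0; 2];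
    [:: 0; 1; 2; 0; 2; 1; 0; 2; 0; 1; 2; 1; 0; 2];
    [:: 0; 1; 2; 0; 1; 0; 2; 1; 2; 0; 1; 2; 1; 0; 2];
    [:: 0; 1; 2; 1; 0; 2; 0; 1; 0; 2; 1; 0; 1; 2; 0; 2];
    [:: 0; 1; 2; 0; 1; 0; 2; 0; 1; 2; 1; 0; 2; 0; 1; 0; 2];
    [:: 0; 1; 2; 0; 1; 0; 2; 1; 2; 0; 1; 2; 1; 0; 1; 2; 0; 2];
    [:: 0; 1; 2; 0; 1; 0; 2; 0; 1; 2; 0; 2; 1; 0; 1; 2; 1; 0; 2];
    [:: 0; 1; 2; 0; 1; 0; 2; 0; 1; 2; 0; 2; 1; 2; 0; 1; 2; 1; 0; 2];
    [:: 0; 1; 2; 0; 1; 0; 2; 0; 1; 2; 0; 2; 1; 0; 2; 0; 1; 2; 1; 0; 2];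
    [:: 0; 1; 2; 0; 1; 0; 2; 1; 2; 0; 2; 1; 0; 1; 2; 1; 0; 2; 0; 1; 0; 2];
    [:: 0; 1; 2; 0; 1; 0; 2; 0; 1; 2; 0; 2; 1; 0; 1; 2; 1; 0; 2; 0; 1; 0; 2];
    [:: 0; 1; 2; 0; 1; 0; 2; 0; 1; 2; 0; 2; 1; 0; 1; 2; 1; 0; 2; 0; 1; 2; 0;
     2];
    [:: 0; 1; 2; 0; 1; 0; 2; 0; 1; 2; 0; 2; 1; 0; 2; 0; 1; 0; 2; 1; 0; 1; 2;
     0; 2];
    [:: 0; 1; 2; 0; 1; 0; 2; 0; 1; 2; 0; 2; 1; 0; 1; 2; 0; 1; 0; 2; 1; 0; 1;
     2; 0; 2];
    [:: 0; 1; 2; 0; 1; 0; 2; 0; 1; 2; 0; 2; 1; 0; 1; 2; 0; 1; 0; 2; 1; 0; 1;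
     2; 1; 0; 2]].

(** These are the first six letters of [block0], so that iterating the first images from 0 produces
    preimages with this beginning. *)
Definition head0 : seq nat := [:: 0; 2; 1; 0; 1; 2].

(* The right-hand connector, read backwards; it depends on the last letter [a]
   of the preimage. *)
Definition last_connector a : seq nat :=
  match a with
  | 0 => [:: 0; 1; 2; 1; 0; 2; 0; 1; 2; 0; 2]
  | 1 => [:: 0; 1; 2; 1; 0; 2; 1; 2; 0; 1; 0]
  | _ => [:: 0; 1; 2; 0; 1; 0; 2; 0; 1; 2; 1]
  end.

Definition start a := pn ++ a.
(** The choices next to a junction are fixed, so that only [a] and [z] enter the finite checks. *)
Definition body z := drop 4 (img [seq (x, false) | x <- z]).
Definition marker a z := last 0 (start a) :: take 12 (body z).

(* The conjuncts about reversed words serve the right-hand end. *)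
Definition junction_ok a z :=
  let w := start a ++ body z in
  [&& nosq_starts (size (start a)) (size (start a) + 12).-1 w,
      occ qn w == 1 & occ (rev qn) w == 1] &&
  [&& avoided (marker a z), avoided (rev (marker a z)),
      occ qn (rev w) == 1 & occ (rev qn) (rev w) == 1].

Lemma left_check : all (fun a => junction_ok a head0) connectors.
Proof. by vm_cast_no_check (erefl true). Qed.

Lemma right_check :
  all (fun z => junction_ok (last_connector (head 0 z)) z) (sqf_words 6).
Proof. by vm_cast_no_check (erefl true). Qed.

(** When the left connector is attached, the word already carries its right end, which is not an
    image; the left marker has to be absent there too. *)
Lemma cross_check :
  all (fun a => all (fun z =>
    ~~ infix (marker a head0) (rev (start (last_connector (head 0 z)) ++ body z)))
    (sqf_words 6)) connectors.
Proof. by vm_cast_no_check (erefl true). Qed.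

Lemma q_check : avoided qn && avoided (rev qn).
Proof. by vm_cast_no_check (erefl true). Qed.

(** * Square-freeness and occurrence counts of the assembled word *)

Lemma occ_sandwich (T : eqType) (v l x m y r : seq T) :
  size v <= (size x).+1 -> size v <= (size y).+1 ->
  ~~ infix v (x ++ m ++ y) ->
  occ v (l ++ x ++ m ++ y ++ r) = occ v (l ++ x) + occ v (y ++ r).
Proof.
move=> lex ley nin; have occ0 s : infix s (x ++ m ++ y) -> occ v s = 0.
  by move=> infs; apply/eqP; rewrite occ_eq0 (contra _ nin) // => /infix_trans->.
have := occ_cat_overlap l (m ++ y ++ r) lex.
rewrite (occ0 x) ?addn0; last by apply/infixP; exists [::], (m ++ y).
have := occ_cat_overlap (x ++ m) r ley.
rewrite (occ0 y) ?addn0; last first.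
  by apply/infixP; exists (x ++ m), [::]; rewrite cats0 catA.
by have := occ0 _ (infix_refl _); rewrite -!catA => -> -> ->.
Qed.

(* The last six letters of the preimage are [rev z]: the right-hand end is the
   mirror image of a left-hand one, and [rev pn = pn]. *)
Definition middle a u s z :=
  a ++ body head0 ++ img (zip u s) ++ rev (body z) ++
  rev (last_connector (head 0 z)).

Lemma size_body z : size z = 6 -> size (body z) = 104.
Proof. by move=> sz; rewrite /body size_drop size_img size_map sz. Qed.

Lemma size_last_connector a : size (last_connector a) = 11.
Proof. by case: a => [|[|a]]. Qed.

Lemma size_middle a u s z : size s = size u -> size z = 6 ->
  size (middle a u s z) = size a + 18 * size u + 219.
Proof.
move=> ss sz; rewrite /middle !size_cat !size_rev !size_body // size_img.
by rewrite size_last_connector size_zip ss minnn; lia.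
Qed.

Lemma ternary_middle a u s z : a \in connectors -> ternary (middle a u s z).
Proof.
have ternary_body y : ternary (body y).
  by apply/allP => i /mem_drop; apply: (allP (ternary_img _)).
move=> a_in; rewrite /middle /ternary !all_cat !all_rev.
have -> : all (fun i => i < 3) a by move: a a_in; apply/allP.
have -> : all (fun i => i < 3) (body z) := ternary_body z.
have -> : all (fun i => i < 3) (img (zip u s)) := ternary_img _.
by case: (head 0 z) => [|[|]].
Qed.

Lemma connectors_size a : a \in connectors -> 10 <= size a <= 27.
Proof. by move: a; apply/allP. Qed.

Lemma middle_nice a u s z (w := pn ++ middle a u s z ++ pn) :
  a \in connectors -> size s = size u -> size z = 6 ->
  ternary (head0 ++ u ++ rev z) -> squarefree (head0 ++ u ++ rev z) ->
  [/\ squarefree w, occ qn w = 2 & occ (rev qn) w = 2].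
Proof.
move=> a_in ss sz tu squ.
(* Reversing an image flips the choices, hence [true] on the right-hand letters. *)
pose c := [seq (x, false) | x <- head0] ++ zip u s ++ [seq (x, true) | x <- rev z].
have unc : unzip1 c = head0 ++ u ++ rev z.
  rewrite /c /unzip1 !map_cat -!map_comp !map_id_in //.
  by rewrite -[map fst (zip u s)]/(unzip1 _) unzip1_zip ?ss.
have sqc : sqf_code c by rewrite /sqf_code unc.
have szc : 2 < size c by rewrite -(size_map fst) -/(unzip1 c) unc size_cat.
have imgc : img c = img [seq (x, false) | x <- head0] ++ img (zip u s) ++
                    rev (img [seq (x, false) | x <- z]).
  by rewrite /c !img_cat rev_img -map_comp -map_rev.
pose r := start (last_connector (head 0 z)).
pose yl := body head0; pose yr := body z; pose mid := img (zip u s).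
have inf_m : infix (yl ++ mid ++ rev yr) (img c).
  apply/infixP; exists (take 4 (img [seq (x, false) | x <- head0])).
  exists (rev (take 4 (img [seq (x, false) | x <- z]))).
  rewrite imgc -[in LHS](cat_take_drop 4 (img [seq (x, false) | x <- z])) rev_cat.
  by rewrite -[in LHS](cat_take_drop 4 (img [seq _ | x <- head0])) -!catA.
have szl : size yl = 104 by [].
have szr : size yr = 104 by apply: size_body.
have [la la'] := andP (connectors_size a_in).
have sqm : squarefree (yl ++ mid ++ rev yr).
  by apply: squarefree_infix inf_m _; apply: squarefree_img.
have z_in : z \in sqf_words 6.
  have infz : infix (rev z) (head0 ++ u ++ rev z).
    by rewrite catA; apply/infixP; exists (head0 ++ u), [::]; rewrite cats0.
  rewrite -sz; apply: mem_sqf_words.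
    by move: tu; rewrite /ternary !all_cat all_rev => /and3P[].
  by rewrite -(revK z); apply: squarefree_rev; apply: squarefree_infix infz squ.
have /andP[/and3P[nsl oql oqbl] /and4P[avl _ _ _]] := allP left_check _ a_in.
have /andP[/and3P[nsr _ _] /and4P[_ avr oqr oqbr]] := allP right_check _ z_in.
have size_marker b y : size (marker b y) <= 13.
  by rewrite /marker /= size_take_min ltnS geq_minl.
have sqr : squarefree (yl ++ mid ++ rev yr ++ rev r).
  rewrite -[_ ++ _]revK; apply: squarefree_rev.
  have -> : rev (yl ++ mid ++ rev yr ++ rev r) = r ++ yr ++ rev mid ++ rev yl.
    by rewrite !rev_cat !revK !catA.
  apply: (@squarefree_glue r yr _ 12) => //.
  - by rewrite szr /r size_cat size_last_connector.
  - by rewrite szr.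
  - apply: contra (avoided_img _ avr szc sqc) => [inf|].
      apply: infix_trans inf_m; rewrite -infix_rev revK.
      by rewrite !rev_cat revK -catA.
    by rewrite size_rev (leq_trans (size_marker _ _)).
  - by have := squarefree_rev sqm; rewrite !rev_cat revK -catA.
have eqw : w = start a ++ yl ++ mid ++ rev yr ++ rev r.
  by rewrite /w /middle /r /start rev_cat -!catA.
have sqw : squarefree (start a ++ yl ++ mid ++ rev yr ++ rev r).
  apply: (@squarefree_glue (start a) yl _ 12) => //.
  - by rewrite szl /start size_cat; move: la'; rewrite /=; lia.
  - have sm : size (marker a head0) <= 13 := size_marker _ _.
    (* The marker has at most 13 letters and [rev yr] has 104, so an occurrence lies in the image
       part or in the right end. *)
    apply/negP; rewrite [yl ++ _]catA => /infix_cat_overlap.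
    rewrite size_rev szr -catA => /(_ (leq_trans sm (isT : 13 <= 105)))/orP[inf|].
      have /negP[] := avoided_img (leq_trans sm (isT : 13 <= 37)) avl szc sqc.
      exact: infix_trans inf inf_m.
    rewrite -rev_cat.
    exact/negP/(allP (allP cross_check _ a_in) _ z_in).
have nin v : size v <= 37 -> avoided v -> ~~ infix v (yl ++ mid ++ rev yr).
  move=> szv avv; apply: contra (avoided_img szv avv szc sqc) => infv.
  exact: infix_trans infv inf_m.
have total v : size v <= 37 -> avoided v ->
    occ v (start a ++ yl) == 1 -> occ v (rev (r ++ yr)) == 1 ->
    occ v (start a ++ yl ++ mid ++ rev yr ++ rev r) = 2.
  move=> szv avv /eqP ol; rewrite rev_cat => /eqP or.
  rewrite occ_sandwich ?ol ?or ?size_rev ?szl ?szr ?nin //.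
    exact: leq_trans szv _.
  exact: leq_trans szv _.
have /andP[avq avqb] := q_check.
by rewrite eqw; split=> //; apply: total.
Qed.

(** * Long square-free preimages and injectivity of the choices *)

(** By [squarefree_img], iterating the morphism of first images from the letter 0 keeps words
    square-free while they grow; a prefix of an iterate is taken. *)
Lemma sqf_word_exists n :
  exists u, [/\ ternary u, squarefree u, size u = n + 6 & take 6 u = head0].
Proof.
pose step w := img [seq (x, false) | x <- w].
(* The default 1 in [head 1 w = 0] excludes the empty word. *)
have stepP i : let w := iter i step [:: 0] in
    [/\ ternary w, squarefree w, i < size w & head 1 w = 0].
  elim: i => [|i /=]; first by split=> // -[|i] [|m] //; rewrite /square_at /= ?andbF.
  set w := iter i step _ => -[tw sqw lt_iw hw].
  have unw : unzip1 [seq (x, false) | x <- w] = w.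
    by rewrite /unzip1 -map_comp map_id_in.
  split; first exact: ternary_img.
  - by apply: squarefree_img; rewrite /sqf_code unw.
  - by rewrite /step size_img size_map; lia.
  - by case: w hw {tw sqw lt_iw unw} => // a w /= ->.
have /= [tw sqw lt_w _] := stepP (n + 6).+1.
have /= [_ _ _] := stepP (n + 6).
set w := iter (n + 6) step _ in tw sqw lt_w *; case: w tw sqw lt_w => // a w.
move=> tw sqw lt_w /= a0; exists (take (n + 6) (step (a :: w))); split.
- by apply/allP => x /mem_take; apply: (allP tw).
- by apply: squarefree_infix sqw; apply: infix_take.
- by rewrite size_takel // ltnW // ltnW.
- by rewrite take_takel ?leq_addl // a0.
Qed.

(** All blocks have equal length, so the images agree block by block; the two images of a letter
    differ. *)
Lemma img_zip_inj u s1 s2 : ternary u -> size s1 = size u -> size s2 = size u ->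
  img (zip u s1) = img (zip u s2) -> s1 = s2.
Proof.
elim: u s1 s2 => [|a u IHu] [|b1 s1] [|b2 s2] //= /andP[lta tu] [sz1] [sz2] /eqP.
rewrite eqseq_cat ?size_block // => /andP[/eqP eqb /eqP/IHu-> //].
by move: a lta eqb => [|[|[|a]]] // _; case: b1; case: b2.
Qed.

(** * Transfer to the alphabet ['I_3] and a lower bound by powers of 2 *)

Lemma occ_map (S T : eqType) (f : S -> T) (u w : seq S) :
  injective f -> occ (map f u) (map f w) = occ u w.
Proof.
move=> injf; have pre x : prefix (map f u) (map f x) = prefix u x.
  by rewrite !prefixE size_map -map_take (inj_eq (inj_map injf)).
elim: w => [|a w IHw]; first by case: u {pre}.
by rewrite map_cons !occ_cons IHw -map_cons pre.
Qed.

Lemma occurrencesE u w : occurrences u w = occ u w.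
Proof.
elim: w => [|a w IHw]; first by rewrite /occurrences /= addn0.
rewrite occ_cons -IHw /occurrences [size _]/=.
rewrite -[iota 0 _.+2]/(0 :: iota (1 + 0) (size w).+1) iotaDl.
by rewrite [LHS]/= count_map.
Qed.

Lemma square_free_val (w : word) : squarefree (map val w) -> square_free w.
Proof.
move=> sqw; apply/square_freeP => u inf_u; apply/squareP => -[m [m_gt0 sz eqw]].
have /infixP[s [t ew]] := inf_u.
have inf_v : infix (map val u) (map val w).
  by apply/infixP; exists (map val s), (map val t); rewrite ew !map_cat.
have /negP[] := squarefree_infix inf_v sqw 0 m.
apply/square_atP; rewrite size_map sz; split=> // k ltk.
rewrite !(nth_map ord0) ?sz; try lia.
by rewrite !add0n addnC eqw.
Qed.

Lemma map_val_inZp (w : seq nat) :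
  ternary w -> map val (map inZp w : seq 'I_3) = w.
Proof.
move=> tw; rewrite -map_comp map_id_in // => a /(allP tw) lta /=.
exact: modn_small.
Qed.

(** One preimage of length [N + 12] is fixed and the choices on its [N] middle letters vary. The
    remaining length is 208 for the two trimmed ends, 11 for the right connector and [10 + r] for
    the left one. *)
Lemma expn_le_card_nice n N r :
  r < 18 -> n = 18 * N + 229 + r -> 2 ^ N <= #|nice_words n|.
Proof.
move=> ltr en; pose a := nth [::] connectors r.
have a_in : a \in connectors by rewrite mem_nth.
have sza : size a = 10 + r.
  have : all (fun i => size (nth [::] connectors i) == 10 + i) (iota 0 18) by [].
  by move/allP/(_ r); rewrite mem_iota => /(_ ltr)/eqP.
have [u0 [tu0 squ0 szu0 hu0]] := sqf_word_exists (N + 6).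
pose u := take N (drop 6 u0); pose z := rev (drop N (drop 6 u0)).
have eu : head0 ++ u ++ rev z = u0 by rewrite revK cat_take_drop -hu0 cat_take_drop.
have szu : size u = N by rewrite size_takel // size_drop szu0; lia.
have szz : size z = 6 by rewrite size_rev !size_drop szu0; lia.
have tu : ternary u by apply/allP => x /mem_take/mem_drop; apply: (allP tu0).
pose W (s : N.-tuple bool) : seq 'I_3 := map inZp (middle a u s z).
have szW s : size (W s) == n.
  by rewrite size_map size_middle ?size_tuple // sza szu en; apply/eqP; lia.
have valW s : map val (W s) = middle a u s z.
  by apply: map_val_inZp; apply: ternary_middle.
pose f s := Tuple (szW s).
have injf : injective f.
  move=> s1 s2 /(congr1 val) /(congr1 (map val)) /=; rewrite !valW => /eqP.
  rewrite /middle; set b := body head0.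
  rewrite eqseq_cat // => /andP[_]; rewrite eqseq_cat // => /andP[_].
  rewrite eqseq_cat; last by rewrite !size_img !size_zip !size_tuple.
  case/andP=> /eqP eqi _; apply: val_inj.
  by apply: (img_zip_inj tu _ _ eqi); rewrite size_tuple.
have -> : 2 ^ N = #|[set f s | s in predT]|.
  by rewrite card_imset // card_tuple card_bool.
apply: subset_leq_card.
apply/subsetP => _ /imsetP[s _ ->]; rewrite inE /nice /=.
have valp : map val p = pn by [].
have valw : map val (p ++ W s ++ p) = pn ++ middle a u s z ++ pn.
  by rewrite map_cat valp map_cat valW valp.
have [| | | |sqw oq oqb] := @middle_nice a u s z a_in; rewrite ?size_tuple ?eu //.
rewrite square_free_val ?valw //= !occurrencesE -!(occ_map _ _ val_inj) valw.
by rewrite -[map val q]/qn -[map val qbar]/(rev qn) oq oqb.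
Qed.

(** * The numerical estimate *)

Import Order.TTheory GRing.Theory Num.Theory.

(** The hypotheses give [x ^ 18 <= 5/4]. After division by [(5/4) ^ N] it remains to see that [(5/4)
    ^ 15 <= 32 < (5/2) ^ 2 * 7.8 <= (8/5) ^ N * 7.8]. *)
Lemma exprn_lt_2exprn (x : rat) N n :
  (1 <= x)%R -> (x ^+ 2 <= 41%:R / 40%:R)%R -> 4 <= N -> n <= 18 * (N + 3 * 5) ->
  (x ^+ n < 2%:R ^+ N * (78%:R / 10%:R))%R.
Proof.
move=> x_ge1 x2_le le4N le_n.
have powW (k : nat) (y z : rat) : (0 <= y -> y <= z -> y ^+ k <= z ^+ k)%R.
  by move=> y0 yz; apply: lerXn2r; rewrite ?nnegrE // (le_trans y0).
have x2_ge0 : (0 <= x ^+ 2)%R by apply: exprn_ge0; apply: le_trans x_ge1.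
have x18 : (x ^+ 18 <= 5%:R / 4%:R)%R.
  have -> : (x ^+ 18 = ((x ^+ 2) ^+ 3) ^+ 3)%R by rewrite -!exprM.
  have x6 : ((x ^+ 2) ^+ 3 <= 14%:R / 13%:R)%R.
    by apply: le_trans (powW 3 _ _ x2_ge0 x2_le) _; lra.
  by apply: le_trans (powW 3 _ _ (exprn_ge0 3 x2_ge0) x6) _; lra.
apply: le_lt_trans (ler_weXn2l x_ge1 le_n) _.
rewrite exprM.
apply: (@le_lt_trans _ _ ((5%:R / 4%:R) ^+ (N + 3 * 5))%R).
  by apply: powW x18; apply: exprn_ge0; apply: le_trans x_ge1.
have -> : (2%:R ^+ N = (5%:R / 4%:R) ^+ N * (8%:R / 5%:R) ^+ N :> rat)%R.
  by rewrite -exprMn; congr (_ ^+ N)%R; lra.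
rewrite exprD -mulrA ltr_pM2l; last by apply: exprn_gt0; lra.
have c15 : ((5%:R / 4%:R) ^+ (3 * 5) <= 2%:R ^+ 5 :> rat)%R.
  by rewrite exprM; apply: powW; lra.
have c4 : ((5%:R / 2%:R) ^+ 2 <= (8%:R / 5%:R) ^+ N :> rat)%R.
  apply: (@le_trans _ _ ((8%:R / 5%:R) ^+ (2 * 2))%R).
    by rewrite exprM; apply: powW; lra.
  by apply: ler_weXn2l le4N; lra.
apply: le_lt_trans c15 _.
apply: (@lt_le_trans _ _ ((5%:R / 2%:R) ^+ 2 * (78%:R / 10%:R))%R); first lra.
by rewrite ler_pM2r; [exact: c4 | lra].
Qed.

Theorem theorem4 (n : nat) (hn : (8750 < n)%N) :
  ((101%:R / 100%:R) ^+ n / (78%:R / 10%:R) < #|nice_words n|%:R :> rat)%R.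
Proof.
pose N := (n - 229) %/ 18; pose r := (n - 229) %% 18.
have en : n = 18 * N + 229 + r.
  rewrite -addnA [229 + r]addnC addnA [18 * N]mulnC -divn_eq subnK //.
  by apply: leq_trans hn.
have ltr : r < 18 by rewrite ltn_mod.
have le4N : 4 <= N by rewrite leq_divRL //; apply: leq_trans (leq_sub2r 229 hn).
have := expn_le_card_nice ltr en; rewrite -(ler_nat rat) natrX.
apply: lt_le_trans; rewrite ltr_pdivrMr; last by lra.
apply: (exprn_lt_2exprn _ _ le4N); [lra | lra |].
(* Here [229 + r <= 246], which is below [18 * 15 = 270]. *)
by rewrite en; move: ltr {hn en}; lia.
Qed.
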